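(* Let $k,n\ge1$ be integers and let $H_n$ be the complete interval hypergraph on $n$ points. The minimum number $\chi^*(H_n)$ of colors in a $k$-SCF coloring of $H_n$ satisfies $$\chi^*(H_n)\ge\left\lceil\frac k2\right\rceil\left\lceil\log_2\frac nk\right\rceil .$$
   Context: The complete interval hypergraph $H_n=(V,\mathcal I)$ has $V=\{1,\dots,n\}$ and $\mathcal I=\{\{i,i+1,\dots,j\}\mid 1\le i\le j\le n\}$. A coloring $C:V\to\mathbb N$ is a $k$-strong conflict-free ($k$-SCF) coloring of $H_n$ if for every $e\in\mathcal I$: when $|e|\le k$ all points of $e$ have pairwise distinct colors; when $|e|>k$ there are at least $k$ colors each of which is assigned to exactly one point of $e$. The number of colors of $C$ is the size of its range. *)

(* Defs.v *)
From mathcomp Require Import all_boot all_order all_algebra.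
From mathcomp Require Import all_classical all_reals all_analysis.

Set Implicit Arguments.
Unset Strict Implicit.
Unset Printing Implicit Defensive.
Import Order.TTheory GRing.Theory Num.Theory.

Record hypergraph := Hypergraph {
  vertex :> finType;
  edges : {set {set vertex}} }.

(* The points 1, ..., n are represented by the ordinals 0, ..., n - 1. *)
Definition interval_hypergraph (n : nat) : hypergraph :=
  @Hypergraph 'I_n
    [set [set x : 'I_n | ij.1 <= x <= ij.2] | ij : 'I_n * 'I_n & ij.1 <= ij.2].

Section Coloring.
Variable H : hypergraph.
Implicit Types (C : H -> nat) (e : {set H}).

Definition colors_of C e : seq nat := undup [seq C x | x in e].

Definition unique_colors C e : seq nat :=
  [seq c <- colors_of C e | #|[set x in e | C x == c]| == 1].

Definition scf_coloring (k : nat) C : Prop :=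
  forall e, e \in edges H ->
    (#|e| <= k -> {in e &, injective C}) /\
    (k < #|e| -> k <= size (unique_colors C e)).

Definition num_colors C : nat := size (colors_of C [set: H]).

Definition scf_colorable (k m : nat) : Prop :=
  exists C, scf_coloring k C /\ num_colors C = m.

Lemma scf_colorable_ex k : exists m, `[< scf_colorable k m >].
Proof.
pose C (x : H) : nat := enum_rank x.
have injC : injective C by move=> x y /ord_inj /enum_rank_inj.
exists (num_colors C); apply/asboolP; exists C; split=> // e _; split.
  by move=> _ x y _ _ /injC.
move=> /ltnW/leq_trans; apply.
suff -> : unique_colors C e = [seq C x | x in e] by rewrite size_image.
rewrite /unique_colors.
have -> : colors_of C e = [seq C x | x in e].
  by apply: undup_id; rewrite map_inj_uniq ?enum_uniq.
apply/all_filterP/allP => _ /mapP[x + ->]; rewrite mem_enum => xe.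
apply/cards1P; exists x.
apply/setP => y; rewrite !inE (inj_eq injC) andbC.
by case: eqP => [->|].
Qed.

(* The minimum exists because injective colorings are k-SCF. *)
Definition scf_chromatic_number (k : nat) : nat := ex_minn (scf_colorable_ex k).

End Coloring.

Definition log2 (R : realType) (x : R) : R := (ln x / ln 2%:R)%R.

(* Main.v *)
(** In an interval with at least [2 k] points, [k] colors occur exactly once.
    Cutting the interval into two halves, at least [ceil (k / 2)] of them occur
    in one half only, hence are missing from the colors of the other half.
    Iterating, an interval with at least [k 2^t] points uses at least
    [ceil (k / 2) (t + 1)] colors; [t = 0] holds since [k] consecutive points
    have distinct colors. *)
Require Import Defs.
From mathcomp Require Import all_boot all_order all_algebra.
From mathcomp Require Import all_classical all_reals all_analysis.
From mathcomp Require Import zify.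
Import Order.TTheory GRing.Theory Num.Theory.

Lemma colors_ofP (H : hypergraph) (C : H -> nat) (e : {set H}) (c : nat) :
  reflect (exists2 x, x \in e & C x = c) (c \in colors_of C e).
Proof.
rewrite /colors_of mem_undup; apply: (iffP mapP) => -[x].
  by rewrite mem_enum => xe ->; exists x.
by move=> xe <-; exists x; rewrite ?mem_enum.
Qed.

Lemma colors_ofS (H : hypergraph) (C : H -> nat) (A B : {set H}) :
  A \subset B -> {subset colors_of C A <= colors_of C B}.
Proof.
by move=> /fintype.subsetP AB c /colors_ofP[x xA <-]; apply/colors_ofP; exists x; rewrite ?AB.
Qed.

Lemma unique_colors_inj (H : hypergraph) (C : H -> nat) (e : {set H}) (x y : H) :
  C x \in unique_colors C e -> x \in e -> y \in e -> C x = C y -> x = y.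
Proof.
rewrite mem_filter => /andP[/cards1P[z ez] _] xe ye Cxy.
have : x \in [set z] by rewrite -ez inE xe eqxx.
have : y \in [set z] by rewrite -ez inE ye Cxy eqxx.
by rewrite !inE => /eqP -> /eqP ->.
Qed.

(** A color that occurs once in the union lies on one side only, so it is new to the other side.
    Splitting these colors by membership in the colors of [A] leaves one class with at least half of
    them, rounded up. Which class is large is not known, hence the [minn]. *)
Lemma size_colors_of_split (H : hypergraph) (C : H -> nat) (A B : {set H}) :
  [disjoint A & B] ->
  uphalf (size (unique_colors C (A :|: B)))
    + minn (size (colors_of C A)) (size (colors_of C B))
    <= size (colors_of C (A :|: B)).
Proof.
move=> dAB; set E := A :|: B; set U := unique_colors C E.
pose inA : pred nat := fun c => c \in colors_of C A.
have sA : A \subset E by apply: finset.subsetUl.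
have sB : B \subset E by apply: finset.subsetUr.
have uU : uniq U by rewrite filter_uniq ?undup_uniq.
have UE : {subset U <= colors_of C E} by move=> c; rewrite mem_filter => /andP[].
(* Unique colors that are missing from [D] can be listed next to the colors of [D] without
   repetition, all within the colors of [E]. *)
have bound (P : pred nat) (D : {set H}) : D \subset E -> {in U, forall c, P c -> c \notin colors_of C D} ->
    count P U + size (colors_of C D) <= size (colors_of C E).
  move=> sD PD; rewrite -size_filter -size_cat; apply: uniq_leq_size.
    rewrite cat_uniq filter_uniq // undup_uniq andbT; apply/hasPn => c cD.
    by rewrite mem_filter; apply/negP => /andP[Pc /PD/(_ Pc)]; rewrite cD.
  move=> c; rewrite mem_cat mem_filter => /orP[/andP[_ /UE]//|].
  exact: colors_ofS.
have hA : count inA U + size (colors_of C B) <= size (colors_of C E).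
  apply: bound => // c cU /colors_ofP[x xA Cx]; apply/colors_ofP => -[y yB Cy].
  have xy : x = y.
    apply: (@unique_colors_inj _ C E); rewrite ?Cx ?Cy //.
      exact: fintype.subsetP xA.
    exact: fintype.subsetP yB.
  by move/disjointFr: dAB => /(_ x xA); rewrite xy yB.
have hB : count (predC inA) U + size (colors_of C A) <= size (colors_of C E).
  by apply: bound.
have := count_predC inA U; lia.
Qed.

(** Start and length are arbitrary so that the induction on [t] applies to both halves; the length
    is only bounded below because the right half absorbs the remainder. *)
Lemma interval_size_colors_of (n k : nat) (C : interval_hypergraph n -> nat)
    (t a l : nat) :
  0 < k -> scf_coloring k C -> a + l <= n -> k * 2 ^ t <= l ->
  uphalf k * t.+1 <= size (colors_of C [set x : 'I_n | a <= x < a + l]).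
Proof.
move=> k0 scfC.
have edge b m : 0 < m -> b + m <= n ->
    [set x : 'I_n | b <= x < b + m] \in edges (interval_hypergraph n).
  move=> m0 bmn; have lb : b < n by lia.
  have lm : (b + m).-1 < n by lia.
  apply/imsetP; exists (Ordinal lb, Ordinal lm); rewrite ?inE /=; first by lia.
  by apply/setP => x; rewrite !inE /=; lia.
have card b m : b + m <= n -> #|[set x : 'I_n | b <= x < b + m]| = m.
  move=> bmn; have inj : injective (fun i : 'I_m => widen_ord bmn (rshift b i)).
    by move=> i j /(congr1 val) /= /addnI /ord_inj.
  rewrite -[RHS]card_ord -cardsT -(card_imset _ inj); apply: eq_card => x.
  rewrite inE; apply/idP/imsetP => [xbm|[i _ ->]] /=; last by have := ltn_ord i; lia.
  have lx : x - b < m by lia.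
  by exists (Ordinal lx); rewrite ?inE //; apply: val_inj => /=; lia.
elim: t a l => [|t IH] a l aln kl.
  (* The interval itself may exceed [k] points, where distinct colors are no longer guaranteed, so
     only its first [k] points are used. *)
  set e := [set x : 'I_n | a <= x < a + k].
  have akn : a + k <= n by lia.
  have ce : #|e| = k by apply: card.
  have [/(_ (eq_leq ce)) inje _] := scfC e (edge a k k0 akn).
  have : size (colors_of C e) = k.
    rewrite /colors_of undup_id ?size_image //.
    by rewrite map_inj_in_uniq ?enum_uniq // => x y; rewrite !mem_enum; apply: inje.
  have : size (colors_of C e)
         <= size (colors_of C [set x : 'I_n | a <= x < a + l]).
    apply: uniq_leq_size; first exact: undup_uniq.
    apply: colors_ofS; apply/fintype.subsetP => x; rewrite !inE; lia.
  by lia.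
(* The left part gets exactly [m] points, the right part the other [l - m], which are at least
   [m]. *)
pose m := k * 2 ^ t.
have ml : m + m <= l by move: kl; rewrite expnS /m; lia.
have km : k <= m by rewrite leq_pmulr ?expn_gt0.
set A := [set x : 'I_n | a <= x < a + m].
set B := [set x : 'I_n | a + m <= x < a + m + (l - m)].
set E := [set x : 'I_n | _].
have EAB : E = A :|: B by apply/setP => x; rewrite !inE; lia.
have dAB : [disjoint A & B].
  by rewrite finset.disjoints_subset; apply/fintype.subsetP => x; rewrite !inE; lia.
have colA : uphalf k * t.+1 <= size (colors_of C A) by apply: IH; lia.
have colB : uphalf k * t.+1 <= size (colors_of C B) by apply: IH; lia.
(* Since [l] is at least [2 * k] and [k] is positive, the interval has strictly more than [k]
   points. *)
have Ul : k <= size (unique_colors C E).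
  have [] := scfC E; first by apply: edge; lia.
  by rewrite card // => _; apply; lia.
have := @size_colors_of_split _ C _ _ dAB; rewrite -EAB => splitE.
have := uphalf_leq Ul; rewrite mulnS; lia.
Qed.

Theorem corollary2 (R : realType) (k n : nat) (hk : (1 <= k)%N) (hn : (1 <= n)%N) :
  (Num.ceil (k%:R / 2%:R : R) * Num.ceil (log2 (n%:R / k%:R : R))
     <= (scf_chromatic_number (interval_hypergraph n) k)%:Z)%R.
Proof.
rewrite /scf_chromatic_number; case: ex_minnP => _ /asboolP[C [scfC <-]] _.
have k0 : (0 < k%:R :> R)%R by rewrite ltr0n.
have n0 : (0 < n%:R :> R)%R by rewrite ltr0n.
have ln2_gt0 : (0 < ln 2%:R :> R)%R by rewrite ln_gt0 // ltr1n.
have ck0 : (0 <= Num.ceil (k%:R / 2%:R : R))%R.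
  by rewrite ceil_ge0 (lt_le_trans (ltrN10 R)) // divr_ge0 ?ler0n.
have ckE : (Num.ceil (k%:R / 2%:R : R) <= (uphalf k)%:Z)%R.
  rewrite ceil_le_int ler_pdivrMr ?ltr0n // -[(_%:~R)%R]/((uphalf k)%:R)%R.
  by rewrite -natrM ler_nat; lia.
(* Only a positive ceiling [t.+1] has content. It means that [t] is strictly below the logarithm, so
   [k * 2 ^ t] is below [n], and the factor [t.+1] of the interval bound matches the ceiling. *)
case ceilE: (Num.ceil (log2 _)) => [[|t]|t]; first by rewrite mulr0.
  apply: (le_trans (ler_wpM2r _ ckE)) => //.
  have kn : k * 2 ^ t <= n.
    have : (t%:R < log2 (n%:R / k%:R : R))%R.
      by rewrite -[(t%:R)%R]/((t%:Z)%:~R)%R -ceil_gt_int ceilE ltz_nat.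
    rewrite /log2 ltr_pdivlMr // (mulr_natl (ln _)) -lnXn // ltr_ln ?posrE ?divr_gt0 ?exprn_gt0 //.
    by rewrite ltr_pdivlMr // -natrX -natrM ltr_nat mulnC => /ltnW.
  rewrite -PoszM lez_nat /num_colors.
  suff -> : [set: interval_hypergraph n] = [set x : 'I_n | 0 <= x < 0 + n].
    exact: interval_size_colors_of.
  by apply/setP => x; rewrite !inE; have := ltn_ord x; lia.
(* A negative ceiling, possible when [n] is smaller than [k], makes the product nonpositive. *)
by rewrite (@le_trans _ _ 0%R) // mulr_ge0_le0.
Qed.
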